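(* Let $\mathbb{X}$ be a reflexive, smooth and strictly convex complex Banach space and let $\mathbb{Y}$ be a proper closed subspace of $\mathbb{X}$. Then the following are equivalent. (i) $\mathbb{Y}$ is $1$-complemented in $\mathbb{X}$. (ii) The closed linear subspace $\bigcap_{f\in\mathbb{X}^*}\{\ker f:\ M_f\subseteq S_{\mathbb{Y}}\}$ is a vector space complement of $\mathbb{Y}$, where $M_f=\{y\in S_{\mathbb{X}}:\ |f(y)|=\|f\|\}$. (iii) $\mathbb{J}_{\mathbb{X}}(\mathbb{Y})$ is isometrically isomorphic to $\mathbb{Y}^*$. (iv) The Hahn-Banach extension operator $\Psi:\mathbb{Y}^*\to\mathbb{X}^*$ is linear.
   Context: $S_{\mathbb{X}}$ denotes the set of unit vectors of $\mathbb{X}$; subspaces are linear. Birkhoff-James orthogonality: $x\perp_B y$ means $\|x+\lambda y\|\ge\|x\|$ for all $\lambda\in\mathbb{C}$; for subspaces, $\mathbb{Y}\perp_B\mathbb{Z}$ means $y\perp_B z$ for all $y\in\mathbb{Y}$, $z\in\mathbb{Z}$. A closed subspace $\mathbb{Y}$ is $1$-complemented (the same as right-complemented) if there is a closed subspace $\widetilde{\mathbb{Y}}$ that is a vector space complement of $\mathbb{Y}$ with $\mathbb{Y}\perp_B\widetilde{\mathbb{Y}}$ (for $\mathbb{Y}\neq\{\mathbf 0\}$ this means that $\mathbb{Y}$ is the range of a norm-one projection). A support functional at $x\neq\mathbf 0$ is $f\in\mathbb{X}^*$ with $\|f\|=\|x\|$, $f(x)=\|x\|^2$; $\mathbb{X}$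 is smooth if each nonzero $x$ has exactly one support functional. The duality map $\mathbb{J}_{\mathbb{X}}:\mathbb{X}\to\mathbb{X}^*$ sends nonzero $x$ to its support functional and $\mathbf 0$ to $\mathbf 0$; $\mathbb{J}_{\mathbb{X}}(\mathbb{Y})=\{\mathbb{J}_{\mathbb{X}}(y):y\in\mathbb{Y}\}$. Statement (iii) includes that $\mathbb{J}_{\mathbb{X}}(\mathbb{Y})$ is a linear subspace of $\mathbb{X}^*$ (with the norm of $\mathbb{X}^*$). The Hahn-Banach extension operator $\Psi$ assigns to $f\in\mathbb{Y}^*$ its norm-preserving linear extension to $\mathbb{X}$, which is unique since $\mathbb{X}^*$ is strictly convex. An intersection over an empty family of kernels is taken to be $\mathbb{X}$. *)

(* Defs.v *)
From HB Require Import structures.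
From mathcomp Require Import all_boot all_order all_algebra.
From mathcomp Require Import complex.
From mathcomp Require Import all_classical all_reals all_analysis.

Set Implicit Arguments.
Unset Strict Implicit.
Unset Printing Implicit Defensive.

Import Order.TTheory GRing.Theory Num.Theory.
Import numFieldNormedType.Exports.

Local Open Scope classical_set_scope.
Local Open Scope ring_scope.
Local Open Scope complex_scope.

(* Complex Banach spaces are [completeNormedModType R[i]] with [R : realType].
   Norms take values in [R[i]]; the order of [R[i]] only compares numbers with
   equal imaginary parts, so on norms it is the usual order of the reals.
   Linear subspaces are [submodClosed] predicates. *)

Section Dual.
Variables (R : realType) (V : normedModType R[i]).

Definition bounded_functional : {pred V -> R[i]^o} :=
  fun f => `[< linear f /\ continuous f >].

Lemma bounded_functionalP (f : V -> R[i]^o) :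
  reflect (linear f /\ continuous f) (f \in bounded_functional).
Proof. exact: asboolP. Qed.

Lemma bounded_functional_submod : submod_closed bounded_functional.
Proof.
split=> [|a f g /bounded_functionalP[lf cf] /bounded_functionalP[lg cg]].
  apply/bounded_functionalP; split; last by move=> x; exact: cvg_cst.
  by move=> a u v; rewrite scaler0 addr0.
apply/bounded_functionalP; split.
  move=> b u v; rewrite /= /GRing.add /= /GRing.scale /= lf lg.
  rewrite /GRing.scale /= !mulrDr !mulrA [b * a]mulrC.
  by rewrite addrACA.
move=> x; apply: (@cvgD _ _ _ _ _ (a *: f) g); last exact: cg.
by apply: cvgZr; exact: cf.
Qed.

HB.instance Definition _ := GRing.isSubmodClosed.Build _ _ bounded_functional
  bounded_functional_submod.

Record dual : Type := Dual {
  dual_fun :> V -> R[i]^o;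
  dual_funP : dual_fun \in bounded_functional }.

HB.instance Definition _ := [isSub for dual_fun].
HB.instance Definition _ := [Choice of dual by <:].
HB.instance Definition _ := [SubChoice_isSubLmodule of dual by <:].

Implicit Types f g : dual.

Lemma dual_linear f : linear f.
Proof. by have /bounded_functionalP[] := dual_funP f. Qed.

HB.instance Definition _ f :=
  GRing.isLinear.Build R[i] V R[i]^o _ (dual_fun f) (dual_linear f).

Lemma dual_continuous f : continuous f.
Proof. by have /bounded_functionalP[] := dual_funP f. Qed.

Lemma dualD f g x : (f + g) x = f x + g x. Proof. by []. Qed.

Lemma dualZ (a : R[i]) f x : (a *: f) x = a * f x. Proof. by []. Qed.

Lemma dual0 x : (0 : dual) x = 0. Proof. by []. Qed.

Lemma dual_eq f g : (forall x, f x = g x) -> f = g.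
Proof. by move=> fg; apply: val_inj; apply/funext. Qed.

Lemma Re_normr (W : normedModType R[i]) (w : W) : (complex.Re `|w|)%:C = `|w|.
Proof. by rewrite RRe_real// realE normr_ge0. Qed.

(* The operator norm; [complex.Re] only reads the real number [`|f x|] in [R]. *)
Definition dual_norm f : R[i] :=
  (sup [set complex.Re `|f x| | x in [set x : V | `|x| <= 1]])%:C.

Lemma dual_norm_ubound f :
  has_ubound [set complex.Re `|f x| | x in [set x : V | `|x| <= 1]].
Proof.
have /(continuous_linear_bounded 0)/bounded_funP/(_ 1)[M fM] :
  {for 0, continuous f} by exact: dual_continuous.
exists (complex.Re M) => _ [x /= x1 <-].
by have := fM x x1; rewrite lecE => /andP[_].
Qed.

Lemma dual_norm_ub f x : `|x| <= 1 -> `|f x| <= dual_norm f.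
Proof.
move=> x1; rewrite -Re_normr lecR; apply: ub_le_sup => //.
  exact: dual_norm_ubound.
by exists x.
Qed.

Lemma dual_norm_le f (M : R[i]) :
  0 <= M -> (forall x, `|x| <= 1 -> `|f x| <= M) -> dual_norm f <= M.
Proof.
move=> M0 fM; rewrite -(RRe_real (ger0_real M0)) lecR; apply: ge_sup.
  by exists (complex.Re `|f 0|), 0 => //=; rewrite normr0 ler01.
by move=> _ [x /= x1 <-]; have := fM x x1; rewrite lecE => /andP[_].
Qed.

Lemma dual_norm_ge0 f : 0 <= dual_norm f.
Proof.
by apply: le_trans (dual_norm_ub f (x := 0) _); rewrite ?normr0 ?ler01.
Qed.

Lemma le_dual_norm f x : `|f x| <= dual_norm f * `|x|.
Proof.
have [->|x0] := eqVneq x 0; first by rewrite linear0 !normr0 mulr0.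
have nx : 0 < `|x| by rewrite normr_gt0.
rewrite -ler_pdivrMr//.
have -> : `|f x| / `|x| = `|f (`|x|^-1 *: x)|.
  by rewrite linearZ normrZ normfV normr_id mulrC.
by apply: dual_norm_ub; rewrite normrZ normfV normr_id mulVf// gt_eqF.
Qed.

Lemma dual_normD f g : dual_norm (f + g) <= dual_norm f + dual_norm g.
Proof.
apply: dual_norm_le => [|x x1]; first by rewrite addr_ge0 ?dual_norm_ge0.
by rewrite dualD (le_trans (ler_normD _ _))// lerD// dual_norm_ub.
Qed.

Lemma dual_normZ_le (a : R[i]) f : dual_norm (a *: f) <= `|a| * dual_norm f.
Proof.
apply: dual_norm_le => [|x x1]; first by rewrite mulr_ge0 ?dual_norm_ge0.
by rewrite dualZ normrM ler_wpM2l// dual_norm_ub.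
Qed.

Lemma dual_norm0 f : dual_norm f = 0 -> f = 0.
Proof.
move=> f0; apply: dual_eq => x; rewrite dual0; apply/normr0_eq0/le_anti.
by rewrite normr_ge0 andbT; have := le_dual_norm f x; rewrite f0 mul0r.
Qed.

Lemma dual_normZ (a : R[i]) f : dual_norm (a *: f) = `|a| * dual_norm f.
Proof.
apply/le_anti; rewrite dual_normZ_le/=.
have [->|a0] := eqVneq a 0; first by rewrite normr0 mul0r dual_norm_ge0.
rewrite -ler_pdivlMl ?normr_gt0// -normfV.
by apply: le_trans (dual_normZ_le _ _); rewrite scalerA mulVf// scale1r.
Qed.

HB.instance Definition _ :=
  @Lmodule_isNormed.Build R[i] dual dual_norm dual_normD dual_normZ dual_norm0.

Lemma dual_normE f : `|f| = dual_norm f. Proof. by []. Qed.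

End Dual.

(* A linear subspace as a normed space in its own right. *)
Section SubNormed.
Variables (R : realType) (V : normedModType R[i]) (Y : submodClosed V).

Record sub_normed : Type := SubNormed {
  sub_val :> V;
  sub_valP : sub_val \in Y }.

HB.instance Definition _ := [isSub for sub_val].
HB.instance Definition _ := [Choice of sub_normed by <:].
HB.instance Definition _ := [SubChoice_isSubLmodule of sub_normed by <:].

Definition sub_norm (y : sub_normed) : R[i] := `|sub_val y|.

Lemma sub_normD y z : sub_norm (y + z) <= sub_norm y + sub_norm z.
Proof. exact: ler_normD. Qed.

Lemma sub_normZ (a : R[i]) y : sub_norm (a *: y) = `|a| * sub_norm y.
Proof. exact: normrZ. Qed.

Lemma sub_norm0 y : sub_norm y = 0 -> y = 0.
Proof. by move=> /normr0_eq0 y0; apply: val_inj. Qed.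

HB.instance Definition _ :=
  @Lmodule_isNormed.Build R[i] sub_normed sub_norm
    sub_normD sub_normZ sub_norm0.

Lemma sub_normE (y : sub_normed) : `|y| = `|sub_val y|. Proof. by []. Qed.

End SubNormed.

Definition isometrically_isomorphic (R : realType)
    (U V : normedModType R[i]) :=
  exists T : {linear U -> V}, bijective T /\ forall u, `|T u| = `|u|.

Section BanachNotions.
Variables (R : realType) (X : normedModType R[i]).
Implicit Types (x y : X) (f : dual X) (Y Z : submodClosed X).

Definition reflexive_space :=
  forall Phi : dual (dual X), exists x, forall f, Phi f = f x.

Definition support_functional x : set (dual X) :=
  [set f : dual X | `|f| = `|x| /\ f x = `|x| ^+ 2].

Definition smooth_space :=
  forall x, x != 0 -> exists! f, support_functional x f.

Definition strictly_convex :=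
  forall x y (t : R), `|x| = 1 -> `|y| = 1 -> x != y -> 0 < t < 1 ->
    `|(1 - t)%:C *: x + t%:C *: y| < 1.

Definition birkhoff_james x y := forall a : R[i], `|x| <= `|x + a *: y|.

Definition unit_sphere : set X := [set x : X | `|x| = 1].

Definition norm_attainment f : set X :=
  [set x | unit_sphere x /\ `|f x| = `|f|].

Definition kernel f : set X := [set x | f x = 0].

Definition complementary Y (Z : set X) :=
  [/\ submod_closed [in Z],
      [set` Y] `&` Z = [set 0] &
      forall x, exists y z, [/\ y \in Y, Z z & x = y + z]].

Definition subspace_orthogonal Y Z :=
  forall y z, y \in Y -> z \in Z -> birkhoff_james y z.

Definition one_complemented Y :=
  exists Z, [/\ closed [set` Z], complementary Y [set` Z] &
    subspace_orthogonal Y Z].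

(* The intersection over an empty family is [setT]. *)
Definition attaining_kernel Y : set X :=
  \bigcap_(f in [set f : dual X |
      norm_attainment f `<=` unit_sphere `&` [set` Y]]) kernel f.

(* When [X] is smooth the support functional picked by [xget] is the only one. *)
Definition duality_map x : dual X :=
  if x == 0 then 0 else xget 0 (support_functional x).

Definition norm_preserving_extension Y (f : dual (sub_normed Y)) :
    set (dual X) :=
  [set g : dual X | `|g| = `|f| /\ forall y : sub_normed Y, g (sub_val y) = f y].

(* The default value [0] of [xget] is never used, by the Hahn-Banach theorem;
   the choice is unique when [dual X] is strictly convex. *)
Definition hahn_banach_operator Y (f : dual (sub_normed Y)) : dual X :=
  xget 0 (norm_preserving_extension f).

End BanachNotions.

(* Main.v *)
Require Import Defs.
From HB Require Import structures.
From mathcomp Require Import all_boot all_order all_algebra.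
From mathcomp Require Import complex.
From mathcomp Require Import all_classical all_reals all_analysis.
From mathcomp Require Import ring lra.

(** Write [J] for the duality map and [Psi] for the Hahn-Banach operator.
    Strict convexity makes the norm-attaining vectors of [J y] multiples of
    [y], so by reflexivity the subspace in (ii) is
    [N = {z | J y z = 0 for all y in Y}], and smoothness turns [y] orthogonal
    to [z] into [J y z = 0]; hence any complement as in (i) is [N]. As [Y] is
    itself reflexive, a functional [g] on [Y] attains its norm in [Y], so
    [Psi g] lies in [J(Y)]. Consequently [J(Y)] is the annihilator of [N] when
    [N] is a complement, and, [J(Y)] restricting isometrically to [Y], it is
    isometric to the dual of [Y] and [Psi] is linear as soon as [J(Y)] is a
    subspace. Conversely, if [Psi] is linear then [g |-> Psi g x] is evaluation
    at a point of [Y], which is the projection of [x] along the common kernel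
    of the functionals [Psi g]. *)

Set Implicit Arguments.
Unset Strict Implicit.
Unset Printing Implicit Defensive.

Import Order.TTheory GRing.Theory Num.Theory.
Import numFieldNormedType.Exports.

Local Open Scope classical_set_scope.
Local Open Scope ring_scope.
Local Open Scope complex_scope.

(** * The Hahn-Banach theorem for sublinear functionals *)

Section Sublinear.
Variables (R : realType) (V : lmodType R[i]).
Implicit Types (p q : V -> R) (x y : V).

(** Homogeneity is asked only as an inequality, which is easy to check for infima; [sublinearZ]
    recovers equality by also using the inverse scalar. *)
Definition sublinear p :=
  (forall x y, p (x + y) <= p x + p y) /\
  (forall (r : R) x, 0 < r -> p (r%:C *: x) <= r * p x).

Lemma sublinearZ p : sublinear p ->
  forall (r : R) x, 0 < r -> p (r%:C *: x) = r * p x.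
Proof.
move=> [_ pZ] r x r0; apply/le_anti; rewrite pZ//=.
have rC : r%:C != 0 by rewrite (inj_eq (@complexI R)) gt_eqF.
have := pZ r^-1 (r%:C *: x); rewrite invr_gt0 => /(_ r0).
by rewrite fmorphV scalerA mulVf// scale1r ler_pdivlMl.
Qed.

Lemma sublinear0 p : sublinear p -> p 0 = 0.
Proof.
move=> sp; have := sublinearZ sp 0 (ltr0n R 2); rewrite scaler0 => p0.
lra.
Qed.

Lemma sublinear_geN p x : sublinear p -> - p (- x) <= p x.
Proof.
move=> sp; have := sp.1 x (- x); rewrite subrr (sublinear0 sp); lra.
Qed.

Lemma inf_leD (A B : set R) (c : R) : A !=set0 -> B !=set0 ->
  (forall a b, A a -> B b -> c <= a + b) -> c <= inf A + inf B.
Proof.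
move=> A0 B0 cAB; rewrite -lerBlDr; apply: lb_le_inf => // a Aa.
rewrite lerBlDr -lerBlDl; apply: lb_le_inf => // b Bb.
by rewrite lerBlDl cAB.
Qed.

(** The index [k] may vary with the vectors. This covers three infima: over translates, over a
    chain, and over a subspace (the distance). *)
Lemma inf_family_sublinear (I : Type) (A : set I) (q : I -> V -> R) :
    A !=set0 -> (forall x, has_lbound [set q i x | i in A]) ->
    (forall i j x y, A i -> A j ->
      exists2 k, A k & q k (x + y) <= q i x + q j y) ->
    (forall (r : R) i x, 0 < r -> A i ->
      exists2 k, A k & q k (r%:C *: x) <= r * q i x) ->
  sublinear (fun x => inf [set q i x | i in A]).
Proof.
move=> [i0 Ai0] lbq qD qZ.
have ne x : [set q i x | i in A] !=set0 by exists (q i0 x), i0.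
split=> [x y|r x r0].
  apply: inf_leD => // _ _ [i Ai <-] [j Aj <-].
  have [k Ak] := qD i j x y Ai Aj; apply: le_trans.
  by apply: ge_inf => //; exists k.
rewrite -ler_pdivrMl//; apply: lb_le_inf => // _ [i Ai <-].
have [k Ak le_k] := qZ r i x r0 Ai.
rewrite ler_pdivrMl//; apply: le_trans le_k.
by apply: ge_inf => //; exists k.
Qed.

Section Translate.
Variables (q : V -> R) (v : V).
Hypothesis sq : sublinear q.

Definition translate (t : R) x := q (x + t%:C *: v) - t * q v.

Definition inf_translate x := inf [set translate t x | t in [set t | 0 <= t]].

Let sqZ0 (t : R) x : 0 <= t -> q (t%:C *: x) = t * q x.
Proof.
rewrite le_eqVlt => /predU1P[<-|t0]; last exact: sublinearZ.
by rewrite rmorph0 scale0r mul0r (sublinear0 sq).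
Qed.

Let translate_lb x : has_lbound [set translate t x | t in [set t | 0 <= t]].
Proof.
(* Subadditivity bounds [t * q v = q (t%:C *: v)] by [q (x + t%:C *: v) + q (- x)]. *)
exists (- q (- x)) => _ [t /= t0 <-]; rewrite /translate.
have := sq.1 (x + t%:C *: v) (- x).
rewrite addrAC subrr add0r sqZ0//; lra.
Qed.

Lemma inf_translate_sublinear : sublinear inf_translate.
Proof.
apply: inf_family_sublinear => //.
- by exists 0 => /=.
- move=> s t x y /= s0 t0; exists (s + t); first by rewrite /= addr_ge0.
  have := sq.1 (x + s%:C *: v) (y + t%:C *: v); rewrite /translate.
  by rewrite addrACA -scalerDl -rmorphD/=; lra.
- move=> r t x r0 /= t0; exists (r * t); first by rewrite /= mulr_ge0// ltW.
  rewrite /translate rmorphM/= -scalerA -scalerDr sublinearZ//; lra.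
Qed.

Lemma inf_translate_le x (t : R) :
  0 <= t -> inf_translate x <= q (x + t%:C *: v) - t * q v.
Proof. by move=> t0; apply: ge_inf => //; exists t. Qed.

End Translate.

Definition real_linear (g : V -> R) :=
  (forall x y, g (x + y) = g x + g y) /\
  (forall (r : R) x, g (r%:C *: x) = r * g x).

(* A sublinear functional [q] that is minimal equals its translate infimum, so
   [q x <= q (x + v) - q v]. *)
Lemma minimal_sublinear_real_linear q : sublinear q ->
    (forall q', sublinear q' -> (forall x, q' x <= q x) ->
      forall x, q x <= q' x) ->
  real_linear q.
Proof.
move=> sq qmin.
have qD x y : q (x + y) = q x + q y.
  apply/le_anti; rewrite sq.1 -lerBrDr; apply: le_trans (qmin _ _ _ x) _.
  - exact: (inf_translate_sublinear y sq).
  - move=> z; have := inf_translate_le y sq z (lexx 0).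
    by rewrite rmorph0 scale0r addr0 mul0r subr0.
  - have := inf_translate_le y sq x (@ler01 R).
    by rewrite rmorph1 scale1r mul1r.
have qN x : q (- x) = - q x.
  by apply/eqP; rewrite -addr_eq0 -qD addNr (sublinear0 sq).
split=> // r x; have [r0|r0|<-] := ltgtP 0 r; first exact: sublinearZ.
- rewrite -[r%:C *: x]opprK qN -scaleNr -rmorphN/= sublinearZ ?oppr_gt0//; lra.
- by rewrite rmorph0 scale0r mul0r (sublinear0 sq).
Qed.

(** Zorn's lemma for the reversed pointwise order. A nonempty chain is bounded by its pointwise
    infimum, which is finite because every member is at least [- p (- x)] at [x]. *)
Lemma exists_minimal_sublinear p : sublinear p ->
  exists q, [/\ sublinear q, forall x, q x <= p x &
    forall q', sublinear q' -> (forall x, q' x <= q x) ->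
      forall x, q x <= q' x].
Proof.
move=> sp; pose T := {q : V -> R | sublinear q /\ forall x, q x <= p x}.
pose below (q q' : T) := `[< forall x, sval q' x <= sval q x >].
have [||A tA|[q [sq qp]] qmin] :=
  @ZL_preorder T (exist _ p (conj sp (fun=> lexx _))) below.
- by move=> q; apply/asboolP.
- move=> q1 q2 q3 /asboolP q12 /asboolP q23; apply/asboolP => x.
  exact: le_trans (q23 x) (q12 x).
- have [[q0 Aq0]|/set0P/negP/negPn/eqP->] := pselect (A !=set0); last first.
    by exists (exist _ p (conj sp (fun=> lexx _))).
  pose s x := inf [set sval q x | q in A].
  have lbA x : has_lbound [set sval q x | q in A].
    exists (- p (- x)) => _ [[q [sq qp]] Aq <-] /=.
    by apply: le_trans (sublinear_geN x sq); rewrite lerN2.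
  have ss : sublinear s.
    refine (@inf_family_sublinear T A (fun t => sval t) _ _ _ _) => //.
    - by exists q0.
    (* In a chain, the pointwise smaller of the two members serves both. *)
    - move=> i j x y Ai Aj; have [/asboolP ij|/asboolP ji] := tA _ _ Ai Aj.
        exists j => //; apply: le_trans ((svalP j).1.1 x y) _.
        by rewrite lerD2r.
      exists i => //; apply: le_trans ((svalP i).1.1 x y) _.
      by rewrite lerD2l.
    - by move=> r i x r0 Ai; exists i => //; apply: (svalP i).1.2.
  have sp' x : s x <= p x.
    apply: le_trans ((svalP q0).2 x); apply: ge_inf => //.
    by exists q0.
  exists (exist _ s (conj ss sp')) => q Aq; apply/asboolP => x /=.
  by apply: ge_inf => //; exists q.
exists q; split=> // q' sq' q'q x.
have q'p y : q' y <= p y by exact: le_trans (q'q y) (qp y).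
have /asboolP := qmin (exist _ q' (conj sq' q'p)) (introT (asboolP _) q'q).
exact.
Qed.

(* A linear functional below [inf_translate p x0], whose value at [- x0] is at
   most [- p x0], must agree with [p] at [x0]. *)
Lemma real_hahn_banach p (x0 : V) : sublinear p ->
  exists g, [/\ real_linear g, forall x, g x <= p x & g x0 = p x0].
Proof.
move=> sp; pose p' := inf_translate p x0.
have sp' : sublinear p' by exact: inf_translate_sublinear.
have [g [sg gp' gmin]] := exists_minimal_sublinear sp'.
have gl := minimal_sublinear_real_linear sg gmin.
have gp x : g x <= p x.
  apply: le_trans (gp' x) _; have := inf_translate_le x0 sp x (lexx 0).
  by rewrite rmorph0 scale0r addr0 mul0r subr0.
exists g; split=> //; apply/le_anti; rewrite gp/=.
have := le_trans (gp' (- x0)) (inf_translate_le x0 sp (- x0) (@ler01 R)).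
rewrite rmorph1 scale1r mul1r addNr (sublinear0 sp) -{1}scaleN1r.
rewrite -(rmorphN1 (real_complex R)).
by rewrite gl.2; lra.
Qed.

(** The complex-linear functional with real part [g] is [g x - i g (i x)]. Invariance of [p] under
    unimodular scalars carries the bound from the real part to the modulus. *)
Lemma complex_hahn_banach p (x0 : V) : sublinear p ->
    (forall (a : R[i]) x, `|a| = 1 -> p (a *: x) <= p x) ->
  exists f : V -> R[i]^o,
    [/\ linear f, forall x, `|f x| <= (p x)%:C & f x0 = (p x0)%:C].
Proof.
move=> sp punit; have [g [[gD gZ] gp gx0]] := real_hahn_banach x0 sp.
pose f x : R[i]^o := g x +i* - g ('i *: x).
have fD x y : f (x + y) = f x + f y.
  by rewrite /f scalerDr !gD opprD.
have fR (r : R) x : f (r%:C *: x) = r%:C * f x.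
  rewrite /f scalerA ['i * _]mulrC -scalerA !gZ.
  apply/eqP; rewrite eq_complex /=.
  by apply/andP; split; apply/eqP; ring.
have fI x : f ('i *: x) = 'i * f x.
  rewrite /f scalerA -expr2 sqr_i -(rmorphN1 (real_complex R)) gZ.
  by apply/eqP; rewrite eq_complex /=; apply/andP; split; apply/eqP; ring.
have fZ (a : R[i]) x : f (a *: x) = a * f x.
  rewrite [a]complexE scalerDl -scalerA fD fI !fR.
  by rewrite mulrDl mulrA.
have fle x : `|f x| <= (p x)%:C.
  have px : 0 <= p x.
    have := punit (-1) x; rewrite normrN1 scaleN1r => /(_ erefl).
    have := sublinear_geN x sp; lra.
  have [fx0|fx0] := eqVneq (f x) 0; first by rewrite fx0 normr0 ler0c.
  have nfx : `|f x| != 0 by rewrite normr_eq0.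
  (* This phase rotates [f x] onto the positive reals, where [f] coincides with [g]. *)
  pose a := `|f x| / f x.
  have a1 : `|a| = 1 by rewrite normrM normfV normr_id divff.
  have <- : f (a *: x) = `|f x| by rewrite fZ /a divfK.
  have : f (a *: x) = (complex.Re (f (a *: x)))%:C.
    by rewrite RRe_real// fZ /a divfK// realE normr_ge0.
  move=> ->; rewrite lecR /=.
  exact: le_trans (gp _) (punit _ _ a1).
exists f; split=> //; first by move=> a x y; rewrite fD fZ.
have px0 : 0 <= p x0 by rewrite -ler0c; apply: le_trans (normr_ge0 _) (fle x0).
(* The real part of [f x0] already has the maximal modulus [p x0], so no room is left for an
   imaginary part. *)
have : `|(f x0 : R[i])| ^+ 2 <= (p x0)%:C ^+ 2.
  by rewrite ler_pXn2r ?nnegrE ?normr_ge0 ?ler0c//; exact: fle.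
rewrite -add_Re2_Im2 -rmorphXn/= lecR gx0 => Im0.
apply/eqP; rewrite eq_complex /= gx0 eqxx/= -sqrf_eq0.
by apply/eqP/le_anti; rewrite sqr_ge0 andbT; lra.
Qed.

End Sublinear.

(** * Functionals on complex normed spaces *)

Section HahnBanach.
Variables (R : realType) (V : normedModType R[i]).
Implicit Types (f g : dual V) (x y z : V) (Y : submodClosed V).

Lemma le_norm_dual f x : `|f x| <= `|f| * `|x|.
Proof. exact: le_dual_norm. Qed.

Lemma dual_norm_le_bound f (M : R[i]) :
  0 <= M -> (forall x, `|f x| <= M * `|x|) -> `|f| <= M.
Proof.
move=> M0 fM; apply: dual_norm_le => // x x1.
by apply: le_trans (fM x) _; rewrite ler_piMr.
Qed.

Lemma bounded_functional_le (f : V -> R[i]^o) (M : R[i]) :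
    linear f -> 0 <= M -> (forall x, `|f x| <= M * `|x|) ->
  f \in @bounded_functional R V.
Proof.
move=> lf M0 fM; pose F : {linear V -> R[i]^o} :=
  HB.pack f (GRing.isLinear.Build _ _ _ _ f lf).
apply/bounded_functionalP; split=> //.
apply: (@bounded_linear_continuous _ _ _ F); apply/linear_boundedP.
exists M; split; first by rewrite realE M0.
move=> r Mr x; apply: le_trans (fM x) _.
by apply: ler_wpM2r => //; exact: ltW.
Qed.

(** Hahn-Banach for the distance [p] to [Z], which vanishes on [Z] and is at most the norm. Infima
    live in [R] and norms in [R[i]], so the distance enters through its lower bounds [d]. *)
Lemma distance_functional (Z : set V) x0 :
    Z 0 -> (forall (a : R[i]) u v, Z u -> Z v -> Z (a *: u + v)) ->
  exists f, [/\ `|f| <= 1, forall z, Z z -> f z = 0 &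
    forall d : R[i], (forall z, Z z -> d <= `|x0 - z|) -> d <= f x0].
Proof.
move=> Z0 Zlin; pose p x := inf [set complex.Re `|x - z| | z in Z].
have leRe x y : `|x| <= `|y| -> complex.Re `|x| <= complex.Re `|y|.
  by rewrite lecE => /andP[].
have ZZ (a : R[i]) z : Z z -> Z (a *: z).
  by move=> Zz; rewrite -[_ *: _]addr0; exact: Zlin.
have lbp x : has_lbound [set complex.Re `|x - z| | z in Z].
  by exists 0 => _ [z Zz <-]; rewrite -ler0c Re_normr normr_ge0.
have ple x z : Z z -> p x <= complex.Re `|x - z|.
  by move=> Zz; apply: ge_inf => //; exists z.
have sp : sublinear p.
  apply: inf_family_sublinear => //.
  - by exists 0.
  - move=> z w x y Zz Zw; exists (z + w).
      by rewrite -[z]scale1r; exact: Zlin.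
    rewrite -lecR rmorphD/= !Re_normr opprD addrACA; exact: ler_normD.
  - move=> r z x r0 Zz; exists (r%:C *: z); first exact: ZZ.
    rewrite -lecR rmorphM/= !Re_normr -scalerBr normrZ ger0_norm//.
    by rewrite ler0c ltW.
have punit (a : R[i]) x : `|a| = 1 -> p (a *: x) <= p x.
  move=> a1; apply: lb_le_inf; first by exists (complex.Re `|x - 0|), 0.
  move=> _ [z Zz <-]; apply: le_trans (ple _ _ (ZZ a z Zz)) _.
  by apply: leRe; rewrite -scalerBr normrZ a1 mul1r.
have [f [lf fp fx0]] := complex_hahn_banach x0 sp punit.
have f1 x : `|f x| <= 1 * `|x|.
  rewrite mul1r; apply: le_trans (fp x) _.
  by rewrite -(Re_normr x) lecR -{2}[x]subr0; exact: ple.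
exists (Dual (bounded_functional_le lf ler01 f1)).
split=> [|z Zz|d dZ] /=; first exact: dual_norm_le_bound.
  apply/normr0_eq0/le_anti; rewrite normr_ge0 andbT.
  apply: le_trans (fp z) _; rewrite -[0](rmorph0 (real_complex R)) lecR.
  by apply: le_trans (ple _ _ Zz) _; rewrite subrr normr0.
(* A complex number comparable with a norm is real. *)
have /complex_realP[d' dE] : d \is Num.real.
  by rewrite (ler_real (dZ _ Z0)) normr_real.
rewrite fx0 dE lecR; apply: lb_le_inf.
  by exists (complex.Re `|x0 - 0|), 0.
by move=> _ [z Zz <-]; rewrite -lecR -dE Re_normr; exact: dZ.
Qed.

Lemma norming_eq f x : `|f| <= 1 -> `|x| <= f x -> f x = `|x|.
Proof.
move=> f1 xf; apply/le_anti; rewrite xf andbT.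
rewrite -(ger0_norm (le_trans (normr_ge0 _) xf)).
by apply: le_trans (le_norm_dual f x) _; rewrite ler_piMl.
Qed.

Lemma norming_functional x : exists2 f : dual V, `|f| <= 1 & f x = `|x|.
Proof.
have [//|a u v -> ->|f [f1 _ fx]] := @distance_functional [set 0] x.
  by rewrite scaler0 addr0.
exists f => //.
by apply: norming_eq => //; apply: fx => z ->; rewrite subr0.
Qed.

Lemma separating_functional Y x : closed [set` Y] -> x \notin Y ->
  exists2 f : dual V, (forall y, y \in Y -> f y = 0) & f x != 0.
Proof.
move=> Ycl xY.
have [|a u v Yu Yv|f [_ fY fx]] := @distance_functional [set` Y] x.
- exact: rpred0.
- by apply: rpredD => //; exact: rpredZ.
exists f => //.
(* The radius of a ball around [x] missing [Y] is a positive lower bound for the distance. *)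
have /nbhs_normP[e /= e0 eY] : nbhs x (~` [set` Y]).
  by apply: open_nbhs_nbhs; split; [exact: closed_openC|exact/negP].
rewrite gt_eqF//; apply: (lt_le_trans e0); apply: fx => y Yy.
rewrite real_leNgt ?normr_real ?gtr0_real//.
by apply/negP => /eY.
Qed.

Lemma support_functional_of_norming f x : `|f| <= 1 -> f x = `|x| ->
  support_functional x (`|x| *: f).
Proof.
move=> f1 fx; split; last by rewrite dualZ fx expr2.
rewrite normrZ normr_id; have [->|x0] := eqVneq x 0.
  by rewrite normr0 mul0r.
rewrite -[RHS]mulr1; congr (_ * _); apply/le_anti; rewrite f1/=.
have := le_norm_dual f x; rewrite fx normr_id -ler_pdivrMr ?normr_gt0//.
by rewrite divff// normr_eq0.
Qed.

(** Orthogonality says that the distance from [x] to the line spanned by [z] is the norm of [x]; the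
    functional realizing this distance, rescaled, is the one sought. *)
Lemma birkhoff_james_support x z : birkhoff_james x z ->
  exists2 f : dual V, support_functional x f & f z = 0.
Proof.
move=> xz; have [|c _ _ [a _ <-] [b _ <-]|f [f1 fz fx]] :=
    @distance_functional [set a *: z | a in [set: R[i]]] x.
- by exists 0 => //; rewrite scale0r.
- by exists (c * a + b) => //; rewrite scalerDl scalerA.
have xf : `|x| <= f x.
  by apply: fx => _ [a _ <-]; rewrite -scaleNr; exact: xz.
exists (`|x| *: f); last first.
  by rewrite dualZ fz ?mulr0//; exists 1; rewrite ?scale1r.
apply: support_functional_of_norming => //.
exact: norming_eq.
Qed.

End HahnBanach.

(** * Reflexivity, subspaces and the duality map *)

(** A functional on the dual that norms [f] is evaluation at some [x]. The value at [f] gives norm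
    at least 1; testing against a functional that norms [x] gives norm at most 1. *)
Lemma reflexive_norm_attained (R : realType) (V : normedModType R[i])
    (f : dual V) :
  reflexive_space V -> f != 0 -> exists2 x, `|x| = 1 & f x = `|f|.
Proof.
move=> Vrefl f0; have [Phi Phi1 Phif] := norming_functional f.
have [x PhiE] := Vrefl Phi; exists x; last by rewrite -PhiE.
apply/le_anti/andP; split; last first.
  have := le_norm_dual f x; rewrite -PhiE Phif normr_id.
  by rewrite -{1}[`|f|]mulr1 ler_pM2l// normr_gt0.
have [h h1 hx] := norming_functional x.
rewrite -hx -PhiE -[X in X <= _]ger0_norm; last by rewrite PhiE hx.
apply: le_trans (le_norm_dual Phi h) _.
by rewrite mulr_ile1.
Qed.

Section Subspace.
Variables (R : realType) (V : normedModType R[i]) (Y : submodClosed V).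
Implicit Types (f : dual V) (g : dual (sub_normed Y)) (y : sub_normed Y).

Let restriction_le f y : `|f (sub_val y)| <= `|f| * `|y|.
Proof. exact: le_norm_dual. Qed.

Lemma restriction_bounded f :
  (fun y => f (sub_val y)) \in @bounded_functional R (sub_normed Y).
Proof.
apply: (bounded_functional_le _ (normr_ge0 f)); last exact: restriction_le.
by move=> a u v; rewrite -linearP.
Qed.

Definition restriction f : dual (sub_normed Y) := Dual (restriction_bounded f).

Lemma restriction_linear : linear restriction.
Proof. by move=> a u v; exact: dual_eq. Qed.

HB.instance Definition _ := GRing.isLinear.Build R[i] (dual V)
  (dual (sub_normed Y)) _ restriction restriction_linear.

Lemma norm_restriction_le f : `|restriction f| <= `|f|.
Proof. by apply: dual_norm_le_bound => // y; exact: restriction_le. Qed.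

(* With [g y0 = 1], a functional vanishing on the kernel of [g] and equal to the
   distance from [y0] to this kernel is a multiple of [g] on [Y]. *)
Lemma norm_preserving_extension_exists g :
  exists f, norm_preserving_extension g f.
Proof.
have [->|g0] := eqVneq g 0.
  by exists 0; split=> //; rewrite !normr0.
have [y0 gy0] : exists y0, g y0 = 1.
  have [y gy] : exists y, g y != 0.
    apply: contrapT => /forallNP gE; move/eqP: g0; apply; apply: dual_eq => y.
    by apply/eqP; have /negP := gE y; rewrite negbK.
  by exists ((g y)^-1 *: y); rewrite linearZ /=; exact: mulVf.
have M0 : 0 < `|g| by rewrite normr_gt0.
have [||f [f1 fZ fy0]] :=
  @distance_functional _ _ [set sub_val y | y in [set y | g y = 0]]
    (sub_val y0).
- by exists 0 => //=; rewrite linear0.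
- move=> a _ _ [u /= gu <-] [v /= gv <-]; exists (a *: u + v) => //=.
  by rewrite linearP /= gu gv scaler0 addr0.
(* For [y] in the kernel of [g], [1 = g (y0 - y)] is at most the norm of [g] times that of
   [y0 - y]. *)
have {fy0}cM : `|g|^-1 <= f (sub_val y0).
  apply: fy0 => _ [y /= gy <-]; rewrite -[_^-1]mulr1 ler_pdivrMl//.
  apply: le_trans (le_norm_dual g (y0 - y)).
  by rewrite linearB /= gy subr0 gy0 normr1.
have c0 : 0 < f (sub_val y0) by rewrite (lt_le_trans _ cM)// invr_gt0.
have fE y : f (sub_val y) = g y * f (sub_val y0).
  apply/eqP; rewrite -subr_eq0; apply/eqP.
  have <- : f (sub_val (y - g y *: y0)) = f (sub_val y) - g y * f (sub_val y0).
    by rewrite /= linearB linearZ.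
  apply: fZ; exists (y - g y *: y0) => //=.
  by rewrite linearB linearZ /= gy0 /GRing.scale /= mulr1 subrr.
exists ((f (sub_val y0))^-1 *: f).
have hE y : ((f (sub_val y0))^-1 *: f) (sub_val y) = g y.
  by rewrite dualZ (fE y) mulrCA mulVf ?mulr1// gt_eqF.
split=> //; apply/le_anti/andP; split.
  rewrite normrZ normfV (gtr0_norm c0) ler_pdivrMl//.
  by apply: le_trans f1 _; rewrite -ler_pdivrMr// mul1r.
by apply: dual_norm_le_bound => // y; rewrite -hE; exact: restriction_le.
Qed.

Lemma hahn_banach_operatorP g :
  norm_preserving_extension g (hahn_banach_operator g).
Proof. by apply: xgetPex; exact: norm_preserving_extension_exists. Qed.

Lemma restriction_hahn_banach g : restriction (hahn_banach_operator g) = g.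
Proof. by apply: dual_eq => y; exact: (hahn_banach_operatorP g).2. Qed.

(** Composed with restriction, [Phi] becomes evaluation at a point [x] of [V]. If [x] were outside
    [Y], a functional vanishing on [Y] but not at [x] would have zero restriction, a
    contradiction. *)
Lemma reflexive_sub_normed : closed [set` Y] -> reflexive_space V ->
  reflexive_space (sub_normed Y).
Proof.
move=> Ycl Vrefl Phi.
have Phi_le f : `|Phi (restriction f)| <= `|Phi| * `|f|.
  apply: le_trans (le_norm_dual _ _) _.
  by apply: ler_wpM2l => //; exact: norm_restriction_le.
have Phi_lin : linear (fun f => Phi (restriction f) : R[i]^o).
  by move=> a f h; rewrite restriction_linear linearP.
have [x xE] :=
  Vrefl (Dual (bounded_functional_le Phi_lin (normr_ge0 _) Phi_le)).
have xY : x \in Y.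
  apply: contrapT => /negP /(separating_functional Ycl)[f fY].
  rewrite -xE /= => /eqP; apply; rewrite -[RHS](linear0 Phi); congr (Phi _).
  by apply: dual_eq => y; apply: fY; exact: sub_valP.
exists (SubNormed xY) => g.
rewrite -{1}(restriction_hahn_banach g) [LHS]xE.
by rewrite -[in RHS](restriction_hahn_banach g).
Qed.

End Subspace.

Section DualityMap.
Variables (R : realType) (X : normedModType R[i]).
Hypothesis X_smooth : smooth_space X.
Implicit Types (f : dual X) (x y z : X).

Local Notation J := (@duality_map R X).

Lemma duality_map_support x : support_functional x (J x).
Proof.
rewrite /duality_map; case: eqP => [->|/eqP x0].
  by split; rewrite ?dual0 !normr0 ?expr0n.
by have [f [fx _]] := X_smooth x0; apply: (xgetPex 0); exists f.
Qed.

Lemma support_functional_uniq x f : support_functional x f -> f = J x.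
Proof.
have [->|x0] := eqVneq x 0.
  by rewrite /duality_map eqxx => -[f0 _]; apply: normr0_eq0; rewrite f0 normr0.
have [h [_ hu]] := X_smooth x0.
by move=> fx; rewrite -(hu _ fx) (hu _ (duality_map_support x)).
Qed.

Lemma norm_duality_map x : `|J x| = `|x|.
Proof. exact: (duality_map_support x).1. Qed.

Lemma duality_map_self x : J x x = `|x| ^+ 2.
Proof. exact: (duality_map_support x).2. Qed.

Lemma norm_attaining_duality_map f x :
  `|x| = 1 -> f x = `|f| -> f = J (`|f| *: x).
Proof.
move=> x1 fx; apply: support_functional_uniq; split.
  by rewrite normrZ normr_id x1 mulr1.
by rewrite linearZ /= fx normrZ normr_id x1 mulr1 expr2.
Qed.

Lemma birkhoff_james_duality_map y z : birkhoff_james y z -> J y z = 0.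
Proof.
by move=> /birkhoff_james_support[f /support_functional_uniq ->].
Qed.

(** After a rotation of [x], [J y] takes the value of its norm at two unit vectors [u] and [v],
    hence at their midpoint. Were they distinct, strict convexity would make the midpoint too
    short. *)
Lemma norm_attainment_duality_map x y : strictly_convex X ->
  norm_attainment (J y) x -> y != 0 -> exists c : R[i], x = c *: y.
Proof.
move=> Xsc [x1 Jx] y0.
have ny : `|y| != 0 by rewrite normr_eq0.
pose c := J y x / `|y|; pose u := c^-1 *: x; pose v := `|y|^-1 *: y.
have c1 : `|c| = 1 by rewrite normrM normfV normr_id Jx norm_duality_map divff.
have c0 : c != 0 by rewrite -normr_eq0 c1 oner_eq0.
have Ju : J y u = `|y|.
  rewrite /u linearZ /= /GRing.scale /= /c invf_div divfK//.
  by rewrite -normr_eq0 Jx norm_duality_map.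
have Jv : J y v = `|y|.
  by rewrite /v linearZ /= duality_map_self /GRing.scale /= expr2 mulKf.
have JD (a b : R[i]) : J y (a *: u + b *: v) = a * J y u + b * J y v.
  by rewrite linearD; congr (_ + _); exact: linearZ.
have u1 : `|u| = 1 by rewrite normrZ normfV c1 invr1 mul1r.
have v1 : `|v| = 1 by rewrite normrZ normfV normr_id mulVf.
have uv : u = v.
  apply/eqP/negPn/negP => uv; pose t : R := 2^-1.
  have t01 : 0 < t < 1 by rewrite /t invr_gt0 invf_lt1 ?ltr0n ?ltr1n.
  have := Xsc u v t u1 v1 uv t01; apply/negP.
  rewrite -real_leNgt ?normr_real ?real1//.
  rewrite -(@ler_pM2l _ `|y|) ?normr_gt0// mulr1 -{2}(norm_duality_map y).
  apply: le_trans (le_norm_dual _ _); rewrite JD Ju Jv.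
  by rewrite -mulrDl -rmorphD/= subrK rmorph1 mul1r normr_id.
by exists (c / `|y|); rewrite -scalerA -/v -uv /u scalerA mulfV// scale1r.
Qed.

End DualityMap.

(** * One-complemented subspaces *)

Lemma submod_closed_set (K : pzRingType) (W : lmodType K) (A : set W) :
  A 0 -> (forall (a : K) u v, A u -> A v -> A (a *: u + v)) ->
  exists Z : submodClosed W, [set` Z] = A.
Proof.
move=> A0 Alin; have Asub : submod_closed [in A].
  split; first exact: mem_set.
  by move=> a u v /set_mem Au /set_mem Av; apply: mem_set; exact: Alin.
pose Z : submodClosed W :=
  HB.pack [in A] (GRing.isSubmodClosed.Build _ _ [in A] Asub).
exists Z; apply/seteqP; split=> x /=; [exact: set_mem | exact: mem_set].
Qed.

Section OneComplemented.
Variables (R : realType) (X : completeNormedModType R[i]).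
Hypotheses (X_reflexive : reflexive_space X) (X_smooth : smooth_space X).
Hypothesis X_strictly_convex : strictly_convex X.
Variable Y : submodClosed X.
Hypothesis Y_closed : closed [set` Y].
Implicit Types (f : dual X) (x z : X).

Local Notation J := (@duality_map R X).

Lemma attaining_kernelE :
  attaining_kernel Y = [set z | forall y, y \in Y -> J y z = 0].
Proof.
apply/seteqP; split=> z /= zN.
  move=> y Yy; have [->|y0] := eqVneq y 0; first by rewrite /duality_map eqxx.
  apply: zN => x Jx; split; first exact: Jx.1.
  have [c ->] := norm_attainment_duality_map X_smooth X_strictly_convex Jx y0.
  exact: rpredZ.
move=> f fY; rewrite /kernel /=; have [->//|f0] := eqVneq f 0.
have [x x1 fx] := reflexive_norm_attained X_reflexive f0.
(* The vector where [f] attains its norm lies in [Y], so [f] is itself in [J(Y)]. *)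
have [|_ Yx] := fY x; first by split=> //; rewrite fx normr_id.
rewrite (norm_attaining_duality_map X_smooth x1 fx).
by apply: zN; exact: rpredZ.
Qed.

Lemma one_complemented_attaining_kernel :
  one_complemented Y -> complementary Y (attaining_kernel Y).
Proof.
move=> [Z [_ YZ orthYZ]]; suff -> : attaining_kernel Y = [set` Z] by [].
have JZ y z : y \in Y -> z \in Z -> J y z = 0.
  by move=> Yy Zz; apply: (birkhoff_james_duality_map X_smooth); exact: orthYZ.
have [_ _ dec] := YZ.
rewrite attaining_kernelE; apply/seteqP; split=> [x xN|z Zz y Yy];
  last exact: JZ.
(* Testing [x = y + z] against [J y] for its own component [y] leaves the squared norm of [y], which
   must be 0. *)
have [y [z [Yy Zz xE]]] := dec x; have := xN y Yy.
rewrite xE linearD /= (JZ y z)// addr0 (duality_map_self X_smooth) => /eqP.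
by rewrite sqrf_eq0 normr_eq0 => /eqP ->; rewrite add0r.
Qed.

Lemma hahn_banach_duality_map (g : dual (sub_normed Y)) :
  exists2 y, y \in Y & hahn_banach_operator g = J y.
Proof.
have [norm_hg hgE] := hahn_banach_operatorP g.
have [g0|g0] := eqVneq g 0.
  exists 0; first exact: rpred0.
  by rewrite /duality_map eqxx; apply: normr0_eq0; rewrite norm_hg g0 normr0.
have [y y1 gy] := reflexive_norm_attained
  (reflexive_sub_normed Y_closed X_reflexive) g0.
(* The extension attains its norm at the same unit vector as [g]; the factor matches the norms. *)
exists (`|g| *: sub_val y); first by apply: rpredZ; exact: sub_valP.
rewrite -norm_hg; apply: norm_attaining_duality_map => //.
by rewrite hgE gy norm_hg.
Qed.

Lemma hahn_banach_duality_image (JY : submodClosed (dual X)) :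
  [set` JY] = J @` [set` Y] ->
  forall g : dual (sub_normed Y), hahn_banach_operator g \in JY.
Proof.
move=> JYE g; suff : [set` JY] (hahn_banach_operator g) by [].
by rewrite JYE; have [y Yy ->] := hahn_banach_duality_map g; exists y.
Qed.

(** Restriction loses no norm because [J y] attains its norm in the direction of [y], inside [Y]. *)
Lemma restriction_duality_map_isometry y :
  y \in Y -> `|restriction Y (J y)| = `|J y|.
Proof.
move=> Yy; apply/le_anti; rewrite norm_restriction_le/= norm_duality_map//.
have [->|y0] := eqVneq y 0; first by rewrite normr0.
have := le_norm_dual (restriction Y (J y)) (SubNormed Yy).
rewrite /= duality_map_self// ger0_norm ?exprn_ge0// expr2.
by rewrite sub_normE /= ler_pM2r// normr_gt0.
Qed.

(** The isomorphism is restriction to [Y], with the Hahn-Banach operator as inverse; injectivity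
    follows from the isometry. *)
Lemma duality_image_isometric (JY : submodClosed (dual X)) :
    [set` JY] = J @` [set` Y] ->
  isometrically_isomorphic (sub_normed JY) (dual (sub_normed Y)).
Proof.
move=> JYE; pose T (u : sub_normed JY) := restriction Y (sub_val u).
have Tlin : linear T by move=> a u v; exact: linearP.
have JYP f : f \in JY -> exists2 y, y \in Y & f = J y.
  move=> fJY; have : [set` JY] f by [].
  by rewrite JYE => -[y Yy <-]; exists y.
have Tnorm u : `|T u| = `|u|.
  rewrite /T sub_normE; have [y Yy ->] := JYP _ (sub_valP u).
  exact: restriction_duality_map_isometry.
have hJY := hahn_banach_duality_image JYE.
pose TL : {linear sub_normed JY -> dual (sub_normed Y)} :=
  HB.pack T (GRing.isLinear.Build _ _ _ _ T Tlin).
exists TL; split; last exact: Tnorm.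
have hK : cancel (fun g => SubNormed (hJY g)) TL.
  by move=> g; exact: restriction_hahn_banach.
exists (fun g => SubNormed (hJY g)) => // u.
apply/eqP; rewrite -subr_eq0 -normr_eq0 -Tnorm.
by rewrite [T _](linearB TL) hK subrr normr0.
Qed.

Lemma complementary_duality_image :
    complementary Y (attaining_kernel Y) ->
  exists JY : submodClosed (dual X), [set` JY] = J @` [set` Y].
Proof.
move=> [_ _ dec]; pose ann := [set f : dual X |
  forall z, attaining_kernel Y z -> f z = 0].
suff -> : J @` [set` Y] = ann.
  apply: submod_closed_set => [z _|a f h fN hN z Nz]; first exact: dual0.
  by rewrite dualD dualZ fN// hN// mulr0 addr0.
have JN y z : y \in Y -> attaining_kernel Y z -> J y z = 0.
  by rewrite attaining_kernelE => Yy /(_ y Yy).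
apply/seteqP; split=> [_ [y Yy <-] z|f fN]; first exact: JN.
(* [J y] and [f] agree on [Y] and both vanish on the complement, hence are equal. *)
have [y Yy hE] := hahn_banach_duality_map (restriction Y f).
exists y => //; apply: dual_eq => x; have [u [z [Yu Nz ->]]] := dec x.
rewrite !linearD /= (JN y z)// (fN z)// -hE; congr (_ + _).
exact: (hahn_banach_operatorP (restriction Y f)).2 (SubNormed Yu).
Qed.

(** The defect of linearity lies in the subspace [J(Y)] and restricts to zero on [Y]; restriction is
    isometric on [J(Y)], so the defect is zero. *)
Lemma duality_image_hahn_banach_linear (JY : submodClosed (dual X)) :
  [set` JY] = J @` [set` Y] -> linear (@hahn_banach_operator R X Y).
Proof.
move=> JYE a g h; apply/eqP; rewrite -subr_eq0; apply/eqP.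
have hJY := hahn_banach_duality_image JYE.
set f := _ - _; have fJY : f \in JY.
  rewrite /f -scaleN1r; apply: rpredD => //; apply: rpredZ.
  by apply: rpredD => //; exact: rpredZ.
have : [set` JY] f by []; rewrite JYE => -[y Yy fE]; apply: normr0_eq0.
rewrite -fE -restriction_duality_map_isometry// fE.
suff -> : restriction Y f = 0 by rewrite normr0.
by rewrite /f linearB linearP /= !restriction_hahn_banach subrr.
Qed.

Lemma hahn_banach_linear_one_complemented :
  linear (@hahn_banach_operator R X Y) -> one_complemented Y.
Proof.
move=> hlin; pose h := @hahn_banach_operator R X Y.
have hE g (y : sub_normed Y) : h g (sub_val y) = g y.
  exact: (hahn_banach_operatorP g).2.
pose N := [set x | forall g, h g x = 0].
have [||Z ZE] := @submod_closed_set _ X N.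
- by move=> g; rewrite linear0.
- move=> a u v uN vN g; rewrite linearP /= uN vN.
  by rewrite scaler0 addr0.
have ZP z g : z \in Z -> h g z = 0.
  by move=> zZ; have : [set` Z] z by []; rewrite ZE => /(_ g).
have orth : subspace_orthogonal Y Z.
  move=> y z Yy Zz a; have [->|y0] := eqVneq y 0; first by rewrite normr0.
  pose g := restriction Y (J y).
  (* As [h g] has the norm of [y], this value bounds the norm of [y + a *: z] below by that of
     [y]. *)
  have hgy : h g (y + a *: z) = `|y| ^+ 2.
    rewrite linearD linearZ /= (ZP z)// scaler0 addr0.
    by rewrite (hE g (SubNormed Yy)) /= duality_map_self.
  have := le_norm_dual (h g) (y + a *: z).
  rewrite hgy (hahn_banach_operatorP g).1 restriction_duality_map_isometry//.
  rewrite norm_duality_map// normrX normr_id expr2 ler_pM2l//.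
  by rewrite normr_gt0.
exists Z; split=> //.
  rewrite ZE (_ : N = \bigcap_(g in setT) (h g @^-1` [set 0])).
    apply: closed_bigI => g _; apply: closed_comp => [x _|].
      exact: dual_continuous.
    exact/accessible_closed_set1/hausdorff_accessible/norm_hausdorff.
  by apply/seteqP; split=> x xN g => [_|]; [exact: xN | exact: (xN g I)].
split.
- split; first by apply: mem_set; exact: rpred0.
  move=> a u v /set_mem Zu /set_mem Zv; apply: mem_set.
  by apply: rpredD => //; exact: rpredZ.
(* A common vector is orthogonal to itself; the scalar [-1] then forces it to be 0. *)
- apply/seteqP; split=> [y [Yy Zy]|_ ->]; last by split; exact: rpred0.
  apply: normr0_eq0; apply/le_anti; rewrite normr_ge0 andbT.
  have := orth y y Yy Zy (-1); rewrite scaleN1r subrr normr0; exact.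
move=> x.
have Phi_le g : `|h g x| <= `|x| * `|g|.
  by rewrite mulrC -(hahn_banach_operatorP g).1; exact: le_norm_dual.
(* Linearity of the operator makes this a functional on the dual of [Y]; the point of [Y]
   representing it differs from [x] by an element of [N]. *)
have Phi_lin : linear (fun g => h g x : R[i]^o).
  by move=> a f g; rewrite /h hlin.
have [y yE] := reflexive_sub_normed Y_closed X_reflexive
  (Dual (bounded_functional_le Phi_lin (normr_ge0 _) Phi_le)).
exists (sub_val y), (x - sub_val y); split; first exact: sub_valP.
  rewrite ZE => g; rewrite linearB /= hE; have /= -> := yE g.
  by rewrite subrr.
by rewrite addrC subrK.
Qed.

End OneComplemented.

Theorem theorem1p5 (R : realType) (X : completeNormedModType R[i])
    (X_reflexive : reflexive_space X) (X_smooth : smooth_space X)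
    (X_strictly_convex : strictly_convex X)
    (Y : submodClosed X) (Y_closed : closed [set` Y])
    (Y_proper : exists x, x \notin Y) :
  [<-> one_complemented Y;
       complementary Y (attaining_kernel Y);
       exists JY : submodClosed (dual X),
         [set` JY] = @duality_map R X @` [set` Y] /\
         isometrically_isomorphic (sub_normed JY) (dual (sub_normed Y));
       linear (@hahn_banach_operator R X Y)].
Proof.
tfae.
- exact: one_complemented_attaining_kernel.
- move=> YN; have [JY JYE] := complementary_duality_image
    X_reflexive X_smooth X_strictly_convex Y_closed YN.
  by exists JY; split=> //; exact: duality_image_isometric.
- by move=> [JY [JYE _]]; exact: duality_image_hahn_banach_linear JYE.
- exact: hahn_banach_linear_one_complemented.
Qed.
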